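(* Let $N,p\ge 1$, let $\Omega\subset[N]$ be a fixed nonempty set, let $A\in\mathbb{R}^{N\times p}$ be the (deterministic) covariate matrix, $\beta^*\in\mathbb{R}^p$, and suppose the responses $Y_i=A_{i,\cdot}\beta^*+\epsilon_i$, $i\in\Omega$, are observed, where the noise $\epsilon=(\epsilon_i)_{i\in\Omega}$ has independent, mean-zero entries with $\mathrm{Var}(\epsilon_i)\le\sigma^2$ and is independent of the observed covariate matrix $Z$. Let $\widehat A=\mathrm{ME}(Z)\in\mathbb{R}^{N\times p}$ be produced by an arbitrary matrix estimation algorithm (any measurable function of $Z$), let $\widehat\beta=(\widehat A^{\Omega})^{\dagger}Y^{\Omega}$ and $\widehat Y=\widehat A\widehat\beta$. Then $$\mathrm{MSE}_{\Omega}(\widehat Y)\le \frac{1}{|\Omega|}\Big(\|\beta^*\|_1^2\cdot \mathrm{MCSE}_{\Omega}(\widehat A)+2\sigma^2\,\mathbb{E}[\mathrm{rank}(\widehat A^{\Omega})]\Big).$$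
   Context: For $B\in\mathbb{R}^{N\times p}$, $B^{\Omega}$ is the $|\Omega|\times p$ submatrix formed by the rows of $B$ indexed by $\Omega$, and $Y^\Omega=(Y_i)_{i\in\Omega}$; $M^\dagger$ is the Moore–Penrose pseudoinverse. The training error is $\mathrm{MSE}_{\Omega}(\widehat Y)=\frac{1}{|\Omega|}\mathbb{E}\big[\sum_{i\in\Omega}(\widehat Y_i-A_{i,\cdot}\beta^* )^2\big]$ and the max column sum error is $\mathrm{MCSE}_{\Omega}(\widehat A)=\mathbb{E}\big[\max_{j\in[p]}\sum_{i\in\Omega}(\widehat A_{ij}-A_{ij})^2\big]$. Here $Z$ is a random (noisy, partially observed) version of $A$ as in the paper's model, and the estimator $\widehat A$ depends on the data only through $Z$. *)

(* Defs.v *)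
From HB Require Import structures.
From mathcomp Require Import all_boot all_order all_algebra.
From mathcomp Require Import all_classical all_reals all_analysis.
Set Implicit Arguments. Unset Strict Implicit. Unset Printing Implicit Defensive.
Import Order.TTheory GRing.Theory Num.Theory.
Local Open Scope classical_set_scope.
Local Open Scope ring_scope.

Definition is_MP_pinv (R : realType) (m n : nat)
  (M : 'M[R]_(m, n)) (X : 'M[R]_(n, m)) : Prop :=
  [/\ M *m X *m M = M, X *m M *m X = X,
      (M *m X)^T = M *m X & (X *m M)^T = X *m M].

Definition rows_in (R : Type) (N p : nat) (Om : {set 'I_N})
  (B : 'M[R]_(N, p)) : 'M[R]_(#|Om|, p) :=
  \matrix_(k < #|Om|, j < p) B (enum_val k) j.

Definition vec_in (R : Type) (N : nat) (Om : {set 'I_N}) (Y : 'I_N -> R)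
  : 'cV[R]_(#|Om|) :=
  \col_(k < #|Om|) Y (enum_val k).

Definition norm1 (R : realType) (p : nat) (b : 'cV[R]_p) : R :=
  \sum_(j < p) `|b j 0|.

Definition mutually_independent d (T : measurableType d) (R : realType)
  (P : probability T R) (n : nat) (S : {set 'I_n}) (e : 'I_n -> T -> R) : Prop :=
  forall B : 'I_n -> set R, (forall i, measurable (B i)) ->
    P [set w | forall i, i \in S -> B i (e i w)]
    = (\prod_(i in S) P (e i @^-1` B i))%E.

(* The random element X (valued in a measurable space V) is independent of the
   random vector (e i)_{i in S}: independence of the generated sigma-algebras,
   checked on the generating pi-system of measurable rectangles. *)
Definition independent_of_vec d d' (T : measurableType d) (V : measurableType d')
  (R : realType) (P : probability T R) (n : nat) (S : {set 'I_n})
  (X : T -> V) (e : 'I_n -> T -> R) : Prop :=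
  forall (A : set V) (B : 'I_n -> set R), measurable A ->
    (forall i, measurable (B i)) ->
    P (X @^-1` A `&` [set w | forall i, i \in S -> B i (e i w)])
    = (P (X @^-1` A) * P [set w | forall i, i \in S -> B i (e i w)])%E.

(* Main.v *)
Require Import Defs.
From HB Require Import structures.
From mathcomp Require Import all_boot all_order all_algebra.
From mathcomp Require Import all_classical all_reals all_analysis.
From mathcomp Require Import measurable_realfun ring lra.
Set Implicit Arguments. Unset Strict Implicit. Unset Printing Implicit Defensive.
Import Order.TTheory GRing.Theory Num.Theory.
Import numFieldNormedType.Exports.
Local Open Scope classical_set_scope.
Local Open Scope ring_scope.

(** Let [H] be the product of the estimated covariate matrix (rows in [Om]) and
    its pseudoinverse: it is the orthogonal projection onto the column space.
    With [y = A beta] and noise [e], the prediction is [H (y + e)], and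
    Pythagoras gives [|H (y + e) - y|^2 = |(1 - H) y|^2 + |H e|^2].  Since
    [1 - H] kills the estimated matrix, the first term equals
    [|(1 - H) (A - Ahat) beta|^2], at most [|beta|_1^2] times the largest
    squared column norm of [A - Ahat].  The second is [sum_kl H_kl e_k e_l]; as
    [H] depends on [Z] only, independence and centering leave
    [sum_k E[H_kk] E[e_k^2] <= sigma^2 E[tr H] = sigma^2 E[rank]]. *)

(** * Orthogonal projections *)

(** Take a rank factorization [H = C *m D] with [C] of full column rank and [D] of full row rank.
    Cancelling both factors in [H *m H = H] leaves [D *m C = 1], whose trace is the rank; cyclicity
    of the trace concludes. *)
Lemma mxrank_idem (F : fieldType) (n : nat) (H : 'M[F]_n) :
  H *m H = H -> (\rank H)%:R = \tr H.
Proof.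
(* The rank becomes a variable, so that the dimensions of the two factors no longer mention [H]. *)
have [r /esym rE] : {r | \rank H = r} by exists (\rank H).
have := mulmx_base H; have := col_base_full H; have := row_base_free H.
move: (col_base H) (row_base H); rewrite -{}rE => C D Dfree Cfull HE HH.
have DC : D *m C = 1%:M.
  apply: (row_full_inj Cfull); apply: (row_free_inj Dfree).
  by rewrite /= mulmx1 mulmxA HE -mulmxA HE HH.
by rewrite -[in RHS]HE mxtrace_mulC DC mxtrace1.
Qed.

Definition sqnorm (R : pzRingType) (n : nat) (v : 'cV[R]_n) : R :=
  \sum_k v k 0 ^+ 2.

Lemma sqnormE (R : realFieldType) n (v : 'cV[R]_n) :
  sqnorm v = (v^T *m v) 0 0.
Proof.
by rewrite /sqnorm mxE; apply: eq_bigr => k _; rewrite mxE expr2.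
Qed.

Lemma sqnorm_ge0 (R : realFieldType) n (v : 'cV[R]_n) : 0 <= sqnorm v.
Proof. by apply: sumr_ge0 => k _; exact: sqr_ge0. Qed.

Lemma sqr_le_sqnorm (R : realFieldType) n (v : 'cV[R]_n) k :
  v k 0 ^+ 2 <= sqnorm v.
Proof.
by rewrite /sqnorm (bigD1 k)//= lerDl; apply: sumr_ge0 => l _; exact: sqr_ge0.
Qed.

Lemma sqnorm_eq0 (R : realFieldType) n (v : 'cV[R]_n) : sqnorm v <= 0 -> v = 0.
Proof.
move=> v0; apply/colP => k; rewrite mxE.
have := le_trans (sqr_le_sqnorm v k) v0.
by rewrite real_exprn_even_le0 ?num_real//= => /eqP.
Qed.

Lemma sqnorm_add_orth (R : realFieldType) n (u v : 'cV[R]_n) :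
  u^T *m v = 0 -> sqnorm (u + v) = sqnorm u + sqnorm v.
Proof.
move=> uv; have vu : v^T *m u = 0 by rewrite -[LHS]trmxK trmx_mul trmxK uv trmx0.
have uvT : (u + v)^T = u^T + v^T by apply/matrixP => i j; rewrite !mxE.
by rewrite !sqnormE uvT mulmxDl !mulmxDr uv vu addr0 add0r mxE.
Qed.

(** To be read with [s] the squared norm of a vector and [x], [y] two of its entries:
    [y ^+ 2 <= s <= y] forces [y <= 1], hence [s <= 1]. It yields bounds on entries of projections
    and of ridge inverses alike. *)
Lemma norm_le1_of_sqr (R : realFieldType) (x y s : R) :
  s <= y -> y ^+ 2 <= s -> x ^+ 2 <= s -> `|x| <= 1.
Proof.
move=> sy ys xs; have y1 : y <= 1 by rewrite leNgt; apply/negP => ?; nra.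
rewrite -(@expr_le1 _ 2)// real_normK ?num_real//.
exact: le_trans xs (le_trans sy y1).
Qed.

Section orthogonal_projection.
Context (R : realFieldType) (n : nat) (H : 'M[R]_n).
Hypotheses (HH : H *m H = H) (HT : H^T = H).

Let HC : H *m (1%:M - H) = 0.
Proof. by rewrite mulmxBr mulmx1 HH subrr. Qed.

Lemma sqnorm_proj_le (v : 'cV[R]_n) : sqnorm ((1%:M - H) *m v) <= sqnorm v.
Proof.
have -> : sqnorm v = sqnorm (H *m v) + sqnorm ((1%:M - H) *m v).
  rewrite -sqnorm_add_orth; first by rewrite -mulmxDl addrC subrK mul1mx.
  by rewrite trmx_mul HT mulmxA -(mulmxA _ H) HC mulmx0 mul0mx.
by rewrite lerDr sqnorm_ge0.
Qed.

Lemma sqnorm_proj_residual (y e : 'cV[R]_n) :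
  sqnorm (H *m (y + e) - y) = sqnorm ((1%:M - H) *m y) + sqnorm (H *m e).
Proof.
have -> : H *m (y + e) - y = H *m e - (1%:M - H) *m y.
  by rewrite mulmxDr mulmxBl mul1mx opprB addrA [H *m e + _]addrC.
have sqN (u : 'cV[R]_n) : sqnorm (- u) = sqnorm u.
  by apply: eq_bigr => k _; rewrite mxE sqrrN.
rewrite [RHS]addrC sqnorm_add_orth; first by rewrite sqN.
by rewrite mulmxN trmx_mul HT mulmxA -(mulmxA _ H) HC mulmx0 mul0mx oppr0.
Qed.

Lemma sqnorm_projE (e : 'cV[R]_n) :
  sqnorm (H *m e) = \sum_k \sum_l H k l * (e k 0 * e l 0).
Proof.
rewrite sqnormE trmx_mul HT mulmxA -(mulmxA _ H H) HH -mulmxA mxE.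
apply: eq_bigr => k _; rewrite !mxE mulr_sumr; apply: eq_bigr => l _.
by rewrite mulrCA.
Qed.

Lemma proj_diagE k : H k k = sqnorm (col k H).
Proof.
rewrite /sqnorm -[in LHS]HH mxE; apply: eq_bigr => i _.
by rewrite mxE expr2 -{1}HT mxE.
Qed.

Lemma proj_diag_ge0 k : 0 <= H k k.
Proof. by rewrite proj_diagE sqnorm_ge0. Qed.

(** Column [l] has squared norm [H l l], which is also one of its entries. The bound makes random
    projections integrable. *)
Lemma proj_entry_le1 k l : `|H k l| <= 1.
Proof.
have := sqr_le_sqnorm (col l H) l; have := sqr_le_sqnorm (col l H) k.
by rewrite -proj_diagE !mxE => kl ll; exact: (norm_le1_of_sqr (lexx (H l l))).
Qed.

End orthogonal_projection.

(** Expand the square into the Gram matrix of the columns of [D]. Each of its entries is at most the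
    largest squared column norm in absolute value, and the coefficients [|b i| * |b j|] sum to
    [norm1 b ^+ 2]. *)
Lemma sqnorm_mul_le_norm1 (R : realType) n p (D : 'M[R]_(n, p)) (b : 'cV[R]_p) :
  sqnorm (D *m b) <=
  norm1 b ^+ 2 * \big[Num.max/0]_(j < p) \sum_k D k j ^+ 2.
Proof.
set C := \big[_/_]_(j < p) _.
have CE j : \sum_k D k j ^+ 2 <= C by exact: le_bigmax.
have -> : sqnorm (D *m b) =
    \sum_i \sum_j b i 0 * b j 0 * (\sum_k D k i * D k j).
  rewrite /sqnorm.
  under eq_bigr do rewrite mxE expr2 mulr_suml.
  rewrite exchange_big; apply: eq_bigr => i _ /=.
  under eq_bigr do rewrite mulr_sumr.
  rewrite exchange_big; apply: eq_bigr => j _ /=.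
  by rewrite mulr_sumr; apply: eq_bigr => k _; ring.
rewrite /norm1 expr2 -mulrA mulr_suml; apply: ler_sum => i _.
rewrite mulr_suml mulr_sumr; apply: ler_sum => j _.
rewrite mulrA; apply: le_trans (ler_norm _) _.
rewrite !normrM ler_wpM2l ?mulr_ge0//.
(* Both bounds come from expanding the nonnegative squared norms of the difference and the sum of
   columns [i] and [j], each column having squared norm at most [C]. *)
have : \sum_k D k i * D k j <= C /\ - (\sum_k D k i * D k j) <= C.
  have := CE i; have := CE j.
  have : 0 <= \sum_k (D k i + D k j) ^+ 2 by apply: sumr_ge0 => k _; exact: sqr_ge0.
  have : 0 <= \sum_k (D k i - D k j) ^+ 2 by apply: sumr_ge0 => k _; exact: sqr_ge0.
  under eq_bigr do rewrite sqrrB.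
  under [in X in _ -> X -> _]eq_bigr do rewrite sqrrD.
  rewrite !big_split/= sumrN !sumrMnl; lra.
by move=> [h1 h2]; rewrite ler_norml lerNl h1 h2.
Qed.

(** * Moore-Penrose projections and their ridge approximation *)

Section pseudoinverse_projection.
Context (R : realType) (m n : nat) (M : 'M[R]_(m, n)) (X : 'M[R]_(n, m)).
Hypothesis MX : is_MP_pinv M X.
Let H := M *m X.

Lemma MP_proj_sym : H^T = H. Proof. by case: MX. Qed.

Lemma MP_projM : H *m M = M. Proof. by case: MX. Qed.

Lemma MP_proj_idem : H *m H = H.
Proof. by rewrite {2}/H mulmxA MP_projM. Qed.

(** [M] and [H] have equal rank, since [H = M *m X] and [M = H *m M]; the trace of the idempotent
    [H] is its rank. *)
Lemma MP_proj_trace : (\rank M)%:R = \tr H.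
Proof.
rewrite -mxrank_idem ?MP_proj_idem//; congr (_%:R).
by apply/eqP; rewrite eqn_leq (mxrankM_maxl M X) -{1}MP_projM mxrankM_maxl.
Qed.

Let G := M *m M^T.

Let gramE (v : 'cV[R]_m) : (v^T *m G *m v) 0 0 = sqnorm (M^T *m v).
Proof. by rewrite sqnormE trmx_mul trmxK !mulmxA. Qed.

(** The quadratic form of [G + t%:M] at [v] is [|M^T v|^2 + t |v|^2], which vanishes only at
    zero. *)
Lemma ridge_unit t : 0 < t -> G + t%:M \in unitmx.
Proof.
move=> t0; rewrite -row_free_unit; apply: inj_row_free => v vB.
apply: trmx_inj; rewrite trmx0; apply: sqnorm_eq0.
have : (v^T^T *m (G + t%:M) *m v^T) 0 0 = 0 by rewrite trmxK vB mul0mx mxE.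
rewrite mulmxDr mulmxDl mul_mx_scalar -scalemxAl [LHS]mxE gramE.
rewrite [X in _ + X]mxE -sqnormE => vE.
have := sqnorm_ge0 (M^T *m v^T); nra.
Qed.

(** Let [u] be row [k] of the scaled inverse. Evaluating the quadratic form at [u] gives
    [|M^T u|^2 + t |u|^2 = t u_k], so [|u|^2 <= u_k] and [norm_le1_of_sqr] applies. The bound is
    uniform in [t]. *)
Lemma ridge_inv_le1 t k l : 0 < t -> `|(t *: invmx (G + t%:M)) k l| <= 1.
Proof.
move=> t0; set B := G + t%:M; set u := (t *: row k (invmx B))^T.
have uB : u^T *m B = t *: delta_mx 0 k.
  by rewrite trmxK -scalemxAl -row_mul mulVmx ?ridge_unit// row1.
have : (u^T *m B *m u) 0 0 = t * u k 0.
  by rewrite uB -scalemxAl -rowE !mxE.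
rewrite mulmxDr mulmxDl mul_mx_scalar -scalemxAl [LHS]mxE gramE.
rewrite [X in _ + X]mxE -sqnormE => uE.
have uk : sqnorm u <= u k 0.
  by have := sqnorm_ge0 (M^T *m u); nra.
have := sqr_le_sqnorm u k; have := sqr_le_sqnorm u l.
have -> : (t *: invmx B) k l = u l 0 by rewrite !mxE.
by move=> ul ukk; exact: (norm_le1_of_sqr uk).
Qed.

(** With [K = X^T *m X], the Penrose equations give [H = G *m K] and [G *m H = G]. Hence the
    difference equals [t *: (W *m K - K)], where the entries of [W] are bounded by 1; the resulting
    rate is linear in [t]. *)
Lemma ridge_proj_dist t k l : 0 < t ->
  `|(invmx (G + t%:M) *m G) k l - H k l| <=
  t * (\sum_i `|(X^T *m X) i l| + `|(X^T *m X) k l|).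
Proof.
move=> t0; set B := G + t%:M; set K := X^T *m X; set W := t *: invmx B.
have HE : H = G *m K.
  rewrite /G /K -mulmxA [M^T *m _]mulmxA -trmx_mul.
  have [_ XMX _ ->] := MX.
  by rewrite XMX.
have GH : G *m H = G.
  by rewrite /G -mulmxA -{1}MP_proj_sym -trmx_mul MP_projM.
have Bu : B \in unitmx by exact: ridge_unit.
have BG : invmx B *m G = 1%:M - W.
  by rewrite -(addrK t%:M G) mulmxBr mulVmx// mul_mx_scalar.
have -> : (invmx B *m G) k l - H k l = ((W *m K) k l - K k l) * t.
  have -> : (invmx B *m G) k l - H k l = (invmx B *m G - H) k l by rewrite !mxE.
  have -> : invmx B *m G - H = t *: (W *m K - K).
    rewrite -[in X in _ - X](mul1mx H) -(mulVmx Bu) -(mulmxA _ B) mulmxDl GH mul_scalar_mx.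
    rewrite mulmxDr opprD addNKr -scalemxAr HE mulmxA BG mulmxBl mul1mx.
    by rewrite -scalerN opprB.
  by rewrite !mxE mulrC.
rewrite normrM (gtr0_norm t0) mulrC ler_pM2l//.
apply: le_trans (ler_normB _ _) _; rewrite lerD2r mxE.
apply: le_trans (ler_norm_sum _ _ _) _; apply: ler_sum => i _.
by rewrite normrM ler_piMl// ridge_inv_le1.
Qed.

End pseudoinverse_projection.

(** * Measurability and independence *)

(** Write [1/f] as [f] times the inverse of [f ^+ 2]: on nonnegative reals the inverse is the
    measurable power of exponent -1. Where [f] vanishes both sides are 0, by the convention on
    [0^-1]. *)
Lemma measurable_funV d (T : measurableType d) (R : realType) (f : T -> R) :
  measurable_fun setT f -> measurable_fun setT (fun x => (f x)^-1).
Proof.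
move=> mf.
have -> : (fun x => (f x)^-1) = f \* ((fun y => y `^ (-1)) \o (fun x => f x ^+ 2)).
  apply/funext => x /=; rewrite powR_inv1 ?sqr_ge0//.
  have [->|f0] := eqVneq (f x) 0; first by rewrite invr0 mul0r.
  by rewrite expr2 invfM mulrA mulfV// mul1r.
apply: measurable_funM => //; apply: measurableT_comp; first exact: measurable_powR.
exact: measurable_funX.
Qed.

Section measurable_matrix.
Context d (T : measurableType d) (R : realType).

Definition measurable_mx m n (F : T -> 'M[R]_(m, n)) : Prop :=
  forall i j, measurable_fun setT (fun x => F x i j).

Lemma measurable_mx_tr m n (F : T -> 'M[R]_(m, n)) :
  measurable_mx F -> measurable_mx (fun x => (F x)^T).
Proof. by move=> mF i j; under eq_fun do rewrite mxE; exact: mF. Qed.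

Lemma measurable_mx_mul m n p (F : T -> 'M[R]_(m, n)) (G : T -> 'M[R]_(n, p)) :
  measurable_mx F -> measurable_mx G -> measurable_mx (fun x => F x *m G x).
Proof.
move=> mF mG i j; under eq_fun do rewrite mxE.
by apply: measurable_sum => k; exact: measurable_funM.
Qed.

Lemma measurable_mx_add m n (F G : T -> 'M[R]_(m, n)) :
  measurable_mx F -> measurable_mx G -> measurable_mx (fun x => F x + G x).
Proof.
by move=> mF mG i j; under eq_fun do rewrite mxE; exact: measurable_funD.
Qed.

Lemma measurable_det n (F : T -> 'M[R]_n) :
  measurable_mx F -> measurable_fun setT (fun x => \det (F x)).
Proof.
move=> mF; rewrite /determinant; apply: measurable_sum => s.
by apply: measurable_funM => //; apply: measurable_prod.
Qed.

(** By Cramer's rule the entries are cofactors divided by the determinant; invertibility at every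
    point selects that branch of [invmx]. *)
Lemma measurable_invmx n (F : T -> 'M[R]_n) : (forall x, F x \in unitmx) ->
  measurable_mx F -> measurable_mx (fun x => invmx (F x)).
Proof.
move=> uF mF i j.
under eq_fun do rewrite /invmx uF !mxE.
apply: measurable_funM; first exact/measurable_funV/measurable_det.
rewrite /cofactor; apply: measurable_funM => //.
by apply: measurable_det => k l; under eq_fun do rewrite !mxE; exact: mF.
Qed.

(* [M *m X] is the limit of the ridge operators [(M M^T + t)^-1 M M^T] as
   [t -> 0+], whose entries are rational functions of those of [M]. *)
Lemma measurable_MP_proj m n (M : T -> 'M[R]_(m, n)) (X : T -> 'M[R]_(n, m)) :
  (forall x, is_MP_pinv (M x) (X x)) -> measurable_mx M ->
  measurable_mx (fun x => M x *m X x).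
Proof.
move=> MX mM k l.
pose G x := M x *m (M x)^T.
have mG : measurable_mx G by apply: measurable_mx_mul => //; exact: measurable_mx_tr.
have t0 j : 0 < (harmonic j : R) by rewrite /harmonic invr_gt0.
pose h j x := (invmx (G x + (harmonic j : R)%:M) *m G x) k l.
apply: (@measurable_fun_cvg _ _ _ setT h) => [j|x _].
  apply: measurable_mx_mul => //; apply: measurable_invmx => [x|].
    exact: ridge_unit.
  by apply: measurable_mx_add => // i i'; exact: measurable_cst.
set C := \sum_i `|((X x)^T *m X x) i l| + `|((X x)^T *m X x) k l|.
have CV : (harmonic j * C : R) @[j --> \oo] --> 0.
  by rewrite -[0](mul0r C); apply: cvgMr_tmp; exact: cvg_harmonic.
pose p := (M x *m X x) k l.
have lo : (p - harmonic j * C : R) @[j --> \oo] --> p.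
  by rewrite -[X in _ --> X]subr0; apply: cvgB CV; exact: cvg_cst.
have up : (p + harmonic j * C : R) @[j --> \oo] --> p.
  by rewrite -[X in _ --> X]addr0; apply: cvgD CV; exact: cvg_cst.
apply: squeeze_cvgr lo up; apply: nearW => j.
by rewrite -ler_distl; exact: ridge_proj_dist.
Qed.

End measurable_matrix.

Section independence.
Context d (T : measurableType d) (R : realType) (P : probability T R).
Local Open Scope ereal_scope.

(** For fixed [A], both sides are finite measures of [S]. They agree on rectangles, a pi-system
    generating the product sigma-algebra, hence everywhere. *)
Lemma indep_pair d0 d1 d2 (V : measurableType d0)
    (T1 : measurableType d1) (T2 : measurableType d2)
    (X : T -> V) (Y1 : T -> T1) (Y2 : T -> T2) :
  measurable_fun setT X -> measurable_fun setT Y1 -> measurable_fun setT Y2 ->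
  (forall A B C, measurable A -> measurable B -> measurable C ->
    P (X @^-1` A `&` (Y1 @^-1` B `&` Y2 @^-1` C)) =
    P (X @^-1` A) * P (Y1 @^-1` B `&` Y2 @^-1` C)) ->
  forall A S, measurable A -> measurable S ->
    P (X @^-1` A `&` (fun w => (Y1 w, Y2 w)) @^-1` S) =
    P (X @^-1` A) * P ((fun w => (Y1 w, Y2 w)) @^-1` S).
Proof.
move=> mX mY1 mY2 XY A S mA mS.
have mXA : measurable (X @^-1` A) by rewrite -[_ @^-1` _]setTI; exact: mX.
pose Y w := (Y1 w, Y2 w).
have mY : measurable_fun setT Y by exact: measurable_fun_pair.
have PXA : P (X @^-1` A) \is a fin_num by exact: fin_num_measure.
have r0 : (0 <= fine (P (X @^-1` A)))%R by rewrite fine_ge0.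
pose pushfwd (mu : {measure set T -> \bar R}) : {measure set (T1 * T2) -> \bar R} :=
  pushforward mu Y.
pose m1 := pushfwd mY (mrestr P mXA).
pose m2 : {measure set (T1 * T2) -> \bar R} := mscale (NngNum r0) (pushfwd mY P).
pose G := [set B `*` C | B in @measurable _ T1 & C in @measurable _ T2].
have m1E D : m1 D = P (X @^-1` A `&` Y @^-1` D) by rewrite setIC.
have m2E D : m2 D = P (X @^-1` A) * P (Y @^-1` D).
  by rewrite /m2/= /mscale/= fineK.
rewrite -m1E -m2E.
apply: (measure_unique G (fun=> setT)) => //.
- exact: measurable_prod_measurableType.
- move=> _ _ [B1 mB1 [C1 mC1 <-]] [B2 mB2 [C2 mC2 <-]]; rewrite -setXI.
  by exists (B1 `&` B2); [exact: measurableI|exists (C1 `&` C2) => //; exact: measurableI].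
- by move=> _; exists setT => //; exists setT => //; rewrite setXTT.
- by rewrite bigcup_const//; exists 0%N.
- by move=> _ [B mB [C mC <-]]; rewrite m1E m2E; exact: XY.
- move=> _; rewrite m1E (le_lt_trans (probability_le1 _ _)) ?ltry//.
  by rewrite preimage_setT setIT.
Qed.

(** Independence identifies the law of [(X, Y)] with the product of the two laws; Fubini on that
    product then separates the factors. *)
Lemma indep_integralM d1 d2 (V : measurableType d1) (W : measurableType d2)
    (X : T -> V) (Y : T -> W) (f : V -> R) (g : W -> R) :
  measurable_fun setT X -> measurable_fun setT Y ->
  (forall A B, measurable A -> measurable B ->
    P (X @^-1` A `&` Y @^-1` B) = P (X @^-1` A) * P (Y @^-1` B)) ->
  measurable_fun setT f -> measurable_fun setT g ->
  P.-integrable setT (fun w => (f (X w))%:E) ->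
  P.-integrable setT (fun w => (g (Y w))%:E) ->
  P.-integrable setT (fun w => (f (X w) * g (Y w))%:E) ->
  \int[P]_w (f (X w) * g (Y w))%:E =
  (\int[P]_w (f (X w))%:E) * \int[P]_w (g (Y w))%:E.
Proof.
move=> mX mY XY mf mg iX iY iXY.
have mZ : measurable_fun setT (fun w => (X w, Y w)) by exact: measurable_fun_pair.
pose X' : {mfun T >-> V} := HB.pack X (isMeasurableFun.Build _ _ _ _ _ mX).
pose Y' : {mfun T >-> W} := HB.pack Y (isMeasurableFun.Build _ _ _ _ _ mY).
pose Z' : {mfun T >-> (V * W)%type} :=
  HB.pack (fun w => (X w, Y w)) (isMeasurableFun.Build _ _ _ _ _ mZ).
pose F (z : V * W) := (f z.1 * g z.2)%:E.
have mF : measurable_fun setT F.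
  by apply/measurable_EFinP/measurable_funM; apply: measurableT_comp.
have prodE S : measurable S -> (distribution P X' \x distribution P Y') S =
    distribution P Z' S.
  by apply: product_measure_unique => A B mA mB; rewrite -XY.
have iF : (distribution P X' \x distribution P Y').-integrable setT F.
  apply/integrableP; split=> //.
  rewrite (eq_measure_integral (distribution P Z'))//; last by move=> S mS _; exact: prodE.
  by have /integrableP[] := integrable_pushforward mZ mF iXY measurableT.
rewrite -[LHS](@integral_distribution _ _ _ _ _ P Z' F mF iXY).
rewrite (eq_measure_integral (distribution P X' \x distribution P Y')); last first.
  by move=> S mS _; exact/esym/prodE.
rewrite -integral12_prod_meas1// /fubini_F /F/=.
have ig : (distribution P Y').-integrable setT (EFin \o g).
  by apply: (integrable_pushforward mY _ iY) => //; exact/measurable_EFinP.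
have gE : \int[distribution P Y']_y (g y)%:E = \int[P]_w (g (Y w))%:E.
  by apply: (@integral_distribution _ _ _ _ _ P Y' (EFin \o g)) => //; exact/measurable_EFinP.
have gfin : \int[P]_w (g (Y w))%:E \is a fin_num by exact: integrable_fin_num.
under eq_integral => x _.
  under eq_integral do rewrite EFinM.
  rewrite integralZl// gE -(fineK gfin).
  over.
rewrite integralZr//; last first.
  by apply: (integrable_pushforward mX _ iX) => //; exact/measurable_EFinP.
rewrite fineK//; congr (_ * _).
by apply: (@integral_distribution _ _ _ _ _ P X' (EFin \o f)) => //; exact/measurable_EFinP.
Qed.

End independence.

Lemma measurable_bigmaxr d (T : measurableType d) (R : realType) (I : Type)
    (s : seq I) (F : I -> T -> R) :
  (forall i, measurable_fun setT (F i)) ->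
  measurable_fun setT (fun w => \big[Num.max/0]_(i <- s) F i w).
Proof.
move=> mF; elim: s => [|i s ih].
  by under eq_fun do rewrite big_nil; exact: measurable_cst.
by under eq_fun do rewrite big_cons; exact: measurable_maxr.
Qed.

(** * Second moments and random quadratic forms *)

Section moments.
Context d (T : measurableType d) (R : realType) (P : probability T R).
Local Open Scope ereal_scope.

Lemma variance_centered (X : T -> R) :
  'E_P[X] = 0 -> 'V_P[X] = \int[P]_w (X w ^+ 2)%:E.
Proof.
move=> EX; rewrite /variance [in LHS]unlock EX/= unlock.
apply: eq_integral => w _.
by rewrite -[((_ * _) w)%R]/((X w - 0) * (X w - 0))%R subr0 expr2.
Qed.

Lemma integrable_sqr (X : T -> R) (s : R) : measurable_fun setT X ->
  \int[P]_w (X w ^+ 2)%:E <= s%:E ->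
  P.-integrable setT (fun w => (X w ^+ 2)%:E).
Proof.
move=> mX Xs; apply/integrableP; split.
  by apply/measurable_EFinP; exact: measurable_funX.
under eq_integral do rewrite gee0_abs ?lee_fin ?sqr_ge0//.
exact: le_lt_trans Xs (ltry _).
Qed.

Lemma integrable_mul_sqr (X Y : T -> R) :
  measurable_fun setT X -> measurable_fun setT Y ->
  P.-integrable setT (fun w => (X w ^+ 2)%:E) ->
  P.-integrable setT (fun w => (Y w ^+ 2)%:E) ->
  P.-integrable setT (fun w => (X w * Y w)%:E).
Proof.
move=> mX mY iX iY; apply: le_integrable (integrableD _ iX iY) => //.
  by apply/measurable_EFinP; exact: measurable_funM.
move=> w _ /=; rewrite lee_fin [leRHS]ger0_norm ?addr_ge0 ?sqr_ge0// ler_norml.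
by apply/andP; split; nra.
Qed.

Lemma integrable_mul_bounded (h X : T -> R) :
  measurable_fun setT h -> (forall w, `|h w| <= 1)%R ->
  P.-integrable setT (fun w => (X w)%:E) ->
  P.-integrable setT (fun w => (h w * X w)%:E).
Proof.
move=> mh h1 iX.
have mX : measurable_fun setT X by exact/measurable_EFinP/(measurable_int _ iX).
apply: le_integrable iX => //; first exact/measurable_EFinP/measurable_funM.
by move=> w _ /=; rewrite lee_fin normrM ler_piMl.
Qed.

Lemma integrable_bounded (h : T -> R) :
  measurable_fun setT h -> (forall w, `|h w| <= 1)%R ->
  P.-integrable setT (fun w => (h w)%:E).
Proof.
move=> mh h1; under eq_fun do rewrite -[h _]mulr1.
apply: integrable_mul_bounded => //.
exact: (finite_measure_integrable_cst P 1%R).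
Qed.

(** Bounded coefficients and finite second moments make every term integrable, so sums and integrals
    commute. After factorization the off-diagonal terms vanish, and [h k k >= 0] lets the second
    moment be replaced by [s] on the diagonal. *)
Lemma integral_quadratic_form_le n (e : 'I_n -> T -> R)
    (h : 'I_n -> 'I_n -> T -> R) (s : R) :
  (forall k, measurable_fun setT (e k)) ->
  (forall k l, measurable_fun setT (h k l)) ->
  (forall k l w, `|h k l w| <= 1)%R -> (forall k w, 0 <= h k k w)%R ->
  (forall k, \int[P]_w (e k w ^+ 2)%:E <= s%:E) ->
  (forall k l, k != l -> \int[P]_w (e k w * e l w)%:E = 0) ->
  (forall k l, \int[P]_w (h k l w * (e k w * e l w))%:E =
     (\int[P]_w (h k l w)%:E) * \int[P]_w (e k w * e l w)%:E) ->
  \int[P]_w (\sum_k \sum_l h k l w * (e k w * e l w))%:E <=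
  s%:E * \int[P]_w (\sum_k h k k w)%:E.
Proof.
move=> me mh h1 h0 es e0 he.
have iee k l : P.-integrable setT (fun w => (e k w * e l w)%:E).
  by apply: integrable_mul_sqr => //; apply: integrable_sqr (es _).
have ihee k l : P.-integrable setT (fun w => (h k l w * (e k w * e l w))%:E).
  exact: integrable_mul_bounded.
under eq_integral.
  move=> w _; rewrite -sumEFin; under eq_bigr do rewrite -sumEFin; over.
rewrite integral_sum//; last by move=> k; exact: integrable_sum.
under [in leRHS]eq_integral do rewrite -sumEFin.
rewrite integral_sum//; last by move=> k; exact: integrable_bounded.
rewrite ge0_sume_distrr; last first.
  by move=> k _; apply: integral_ge0 => w _; rewrite lee_fin.
apply: lee_sum => k _.
rewrite integral_sum// (bigD1 k)//= big1 => [|l lk]; last first.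
  by rewrite he e0 ?mule0// eq_sym.
rewrite adde0 he muleC; apply: lee_wpmul2r; last exact: es.
by apply: integral_ge0 => w _; rewrite lee_fin.
Qed.

End moments.

(** * Independence for pairs of noise coordinates *)

Section noise.
Context d (T : measurableType d) (R : realType) (P : probability T R).
Context n (S : {set 'I_n}) (e : 'I_n -> T -> R).
Local Open Scope ereal_scope.

(** A box constraining only coordinates [i] and [j]. The intersection keeps both constraints when
    [i = j]. *)
Let B (i j : 'I_n) (U W : set R) (k : 'I_n) : set R :=
  (if k == i then U else setT) `&` (if k == j then W else setT).

Let mB i j U W k : measurable U -> measurable W -> measurable (B i j U W k).
Proof. by move=> mU mW; apply: measurableI; case: ifP. Qed.

Let BE i j U W : i \in S -> j \in S ->
  [set w | forall k, k \in S -> B i j U W k (e k w)] =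
  e i @^-1` U `&` e j @^-1` W.
Proof.
move=> iS jS; apply/seteqP; split => w /=.
  move=> Bw; have := Bw _ iS; have := Bw _ jS.
  by rewrite /B !eqxx => -[_ ?] [].
by move=> [Uw Ww] k _; rewrite /B; split; case: eqP => // ->.
Qed.

(** The case [i = j] is included, as the diagonal terms of the quadratic form require it. *)
Lemma independent_of_vec_pair d' (V : measurableType d') (Z : T -> V) i j U W A :
  independent_of_vec P S Z e -> i \in S -> j \in S ->
  measurable A -> measurable U -> measurable W ->
  P (Z @^-1` A `&` (e i @^-1` U `&` e j @^-1` W)) =
  P (Z @^-1` A) * P (e i @^-1` U `&` e j @^-1` W).
Proof.
by move=> ind iS jS mA mU mW; rewrite -BE//; apply: ind => // k; exact: mB.
Qed.

Lemma mutually_independent_pair i j U W :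
  mutually_independent P S e -> i \in S -> j \in S -> i != j ->
  measurable U -> measurable W ->
  P (e i @^-1` U `&` e j @^-1` W) = P (e i @^-1` U) * P (e j @^-1` W).
Proof.
move=> ind iS jS ij mU mW; rewrite -BE// ind; last by move=> k; exact: mB.
rewrite (bigD1 i)//= (bigD1 j)/=; last by rewrite jS eq_sym.
rewrite big1 => [|k /andP[/andP[_ ki] kj]].
  by rewrite mule1 /B !eqxx (negbTE ij) eq_sym (negbTE ij) setIT setTI.
by rewrite /B (negbTE ki) (negbTE kj) setTI preimage_setT probability_setT.
Qed.

End noise.

(** * The risk bound at a fixed outcome *)

Section projection_risk.
Context (R : realType) (N p : nat) (Om : {set 'I_N}) (A B : 'M[R]_(N, p)).
Context (X : 'M[R]_(p, #|Om|)) (beta : 'cV[R]_p) (e : 'I_N -> R).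
Hypothesis BX : is_MP_pinv (rows_in Om B) X.
Let H := rows_in Om B *m X.

Lemma training_error_sqnormE :
  \sum_(i in Om) ((B *m (X *m vec_in Om (fun i => (A *m beta) i 0 + e i))) i 0
                   - (A *m beta) i 0) ^+ 2 =
  sqnorm (H *m (rows_in Om A *m beta + vec_in Om e) - rows_in Om A *m beta).
Proof.
have rowsM (C : 'M[R]_(N, p)) (v : 'cV[R]_p) k :
    (C *m v) (enum_val k) 0 = (rows_in Om C *m v) k 0.
  by rewrite !mxE; apply: eq_bigr => j _; rewrite mxE.
have -> : vec_in Om (fun i => (A *m beta) i 0 + e i) =
    rows_in Om A *m beta + vec_in Om e.
  by apply/colP => k; rewrite mxE [RHS]mxE rowsM [in RHS]mxE; congr (_ + _); rewrite mxE.
rewrite big_enum_val; apply: eq_bigr => k _ /=.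
by rewrite !rowsM mulmxA -/H [in RHS]mxE; congr ((_ + _) ^+ 2); rewrite [RHS]mxE.
Qed.

Lemma training_error_le :
  sqnorm (H *m (rows_in Om A *m beta + vec_in Om e) - rows_in Om A *m beta) <=
  norm1 beta ^+ 2 * \big[Num.max/0]_(j < p) \sum_(i in Om) (B i j - A i j) ^+ 2 +
  \sum_k \sum_l H k l * (e (enum_val k) * e (enum_val l)).
Proof.
have HH := MP_proj_idem BX; have HT := MP_proj_sym BX.
rewrite (sqnorm_proj_residual HH HT) (sqnorm_projE HH HT).
under [X in _ + X <= _]eq_bigr do under eq_bigr do
  rewrite [vec_in _ _ _ _]mxE [X in _ * (_ * X)]mxE.
rewrite lerD2r.
(* Subtracting the estimate is free because [1 - H] annihilates it; this turns the bias into an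
   estimation error. *)
have -> : (1%:M - H) *m (rows_in Om A *m beta) =
    (1%:M - H) *m ((rows_in Om A - rows_in Om B) *m beta).
  have HB : (1%:M - H) *m rows_in Om B = 0.
    by rewrite mulmxBl mul1mx (MP_projM BX) subrr.
  by rewrite (mulmxBl (rows_in Om A)) [RHS]mulmxBr (mulmxA _ (rows_in Om B)) HB mul0mx subr0.
apply: le_trans (sqnorm_proj_le HH HT _) _.
apply: le_trans (sqnorm_mul_le_norm1 _ _) _.
rewrite ler_wpM2l ?sqr_ge0// le_eqVlt; apply/orP; left; apply/eqP.
apply: eq_bigr => j _; rewrite [RHS]big_enum_val; apply: eq_bigr => k _.
by rewrite !mxE -sqrrN opprB.
Qed.

End projection_risk.

(** * Taking expectations of the pointwise bound *)

Unset Implicit Arguments.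

Theorem mainTheorem1
  (d : measure_display) (T : measurableType d) (R : realType)
  (P : probability T R)
  (N p : nat) (hN : (1 <= N)%N) (hp : (1 <= p)%N)
  (Om : {set 'I_N}) (hOm : (0 < #|Om|)%N)
  (A : 'M[R]_(N, p)) (beta : 'cV[R]_p) (sigma : R)
  (dV : measure_display) (V : measurableType dV) (Z : T -> V)
  (hZ : measurable_fun setT Z)
  (ME : V -> 'M[R]_(N, p))
  (hME : forall i j, measurable_fun setT (fun z => ME z i j))
  (eps : 'I_N -> T -> R)
  (heps_meas : forall i, i \in Om -> measurable_fun setT (eps i))
  (heps_int : forall i, i \in Om -> P.-integrable setT (EFin \o eps i))
  (heps_mean : forall i, i \in Om -> ('E_P[eps i] = 0)%E)
  (heps_var : forall i, i \in Om -> ('V_P[eps i] <= (sigma ^+ 2)%:E)%E)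
  (heps_indep : mutually_independent P Om eps)
  (hZeps : independent_of_vec P Om Z eps)
  (pinv : 'M[R]_(#|Om|, p) -> 'M[R]_(p, #|Om|))
  (hpinv : forall M, is_MP_pinv M (pinv M)) :
  let Y : T -> 'I_N -> R := fun w i => (A *m beta) i 0 + eps i w in
  let Ahat : T -> 'M[R]_(N, p) := fun w => ME (Z w) in
  let betahat : T -> 'cV[R]_p :=
    fun w => pinv (rows_in Om (Ahat w)) *m vec_in Om (Y w) in
  let Yhat : T -> 'cV[R]_N := fun w => Ahat w *m betahat w in
  let MSE : \bar R :=
    (((#|Om|%:R)^-1)%:E *
      \int[P]_w (\sum_(i in Om) (Yhat w i 0 - (A *m beta) i 0) ^+ 2)%:E)%E in
  let MCSE : \bar R :=
    (\int[P]_w (\big[Num.max/0]_(j < p)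
                 \sum_(i in Om) (Ahat w i j - A i j) ^+ 2)%:E)%E in
  (MSE <= ((#|Om|%:R)^-1)%:E *
          ((norm1 beta ^+ 2)%:E * MCSE
           + (2 * sigma ^+ 2)%:E *
               \int[P]_w ((\rank (rows_in Om (Ahat w)))%:R)%:E))%E.
Proof.
cbv beta zeta.
pose H z := rows_in Om (ME z) *m pinv (rows_in Om (ME z)).
pose e (k : 'I_#|Om|) := eps (enum_val k).
pose q w := \sum_k \sum_l H (Z w) k l * (e k w * e l w).
pose mcs w := \big[Num.max/0]_(j < p) \sum_(i in Om) (ME (Z w) i j - A i j) ^+ 2.
have eOm (k : 'I_#|Om|) : enum_val k \in Om by exact: enum_valP.
have HH z : H z *m H z = H z by exact: (MP_proj_idem (hpinv _)).
have HT z : (H z)^T = H z by exact: (MP_proj_sym (hpinv _)).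
have mM : measurable_mx (fun z => rows_in Om (ME z)).
  by move=> k j; under eq_fun do rewrite mxE; exact: hME.
(* [pinv] is any choice of pseudoinverse, with no measurability assumed; that of the projection
   comes from the ridge limit. *)
have mH : measurable_mx H by exact: measurable_MP_proj.
have mHZ : measurable_mx (fun w => H (Z w)).
  by move=> k l; exact: (measurableT_comp (mH k l) hZ).
have me k : measurable_fun setT (e k) by exact: heps_meas.
have mq : measurable_fun setT q.
  apply: measurable_sum => k; apply: measurable_sum => l.
  by apply: measurable_funM => //; exact: measurable_funM.
have mmcs : measurable_fun setT mcs.
  apply: measurable_bigmaxr => j; under eq_fun do rewrite big_enum_val.
  apply: measurable_sum => k; apply/measurable_funX/measurable_funB => //.
  exact: (measurableT_comp (hME _ _) hZ).
have mcs0 w : 0 <= mcs w by exact: bigmax_ge_id.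
(* [q] is the squared norm of the projected noise, so its integral can be split off without
   integrability of the other term. *)
have q0 w : 0 <= q w.
  suff -> : q w = sqnorm (H (Z w) *m \col_k e k w) by exact: sqnorm_ge0.
  rewrite (sqnorm_projE (HH _) (HT _)); apply: eq_bigr => k _.
  by apply: eq_bigr => l _; congr (_ * (_ * _)); rewrite mxE.
have e2 k : (\int[P]_w (e k w ^+ 2)%:E <= (sigma ^+ 2)%:E)%E.
  by rewrite -variance_centered; [exact: heps_var|exact: heps_mean].
have iee k l : P.-integrable setT (fun w => (e k w * e l w)%:E).
  by apply: integrable_mul_sqr => //; apply: integrable_sqr (e2 _).
have e0 k l : k != l -> (\int[P]_w (e k w * e l w)%:E = 0)%E.
  move=> kl; rewrite (@indep_integralM _ _ _ P _ _ _ _ (e k) (e l) id id)//.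
  - by have := heps_mean _ (eOm k); rewrite expectation.unlock => ->; rewrite mul0e.
  - move=> U W mU mW; apply: (mutually_independent_pair heps_indep) => //.
    by apply: contra kl => /eqP/enum_val_inj ->.
  - exact: heps_int.
  - exact: heps_int.
have H1 k l w : `|H (Z w) k l| <= 1 by exact: proj_entry_le1.
have qE : (\int[P]_w (q w)%:E <= (sigma ^+ 2)%:E *
    \int[P]_w ((\rank (rows_in Om (ME (Z w))))%:R)%:E)%E.
  under [in leRHS]eq_integral do rewrite (MP_proj_trace (hpinv _)).
  apply: (integral_quadratic_form_le (h := fun k l w => H (Z w) k l)) => //.
    by move=> k w; exact: proj_diag_ge0.
  move=> k l.
  have mek : measurable_fun setT (fun w => (e k w, e l w)) by exact: measurable_fun_pair.
  apply: (@indep_integralM _ _ _ P _ _ _ _ Z (fun w => (e k w, e l w))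
    (fun z => H z k l) (fun x => x.1 * x.2)) => //.
  (* [hZeps] speaks of rectangles only; [indep_pair] extends it to all events of the pair, as the
     product [e k * e l] requires. *)
  - move=> U S mU mS; apply: indep_pair => // A' B C mA mB mC.
    by apply: (independent_of_vec_pair hZeps).
  - exact: measurable_funM.
  - by apply: integrable_bounded => // w; exact: H1.
  - exact: iee.
  - exact: (integrable_mul_bounded (mHZ k l) (H1 k l) (iee k l)).
apply: lee_wpmul2l; first by rewrite lee_fin invr_ge0.
under eq_integral do rewrite (training_error_sqnormE _ _ (pinv (rows_in Om (ME (Z _))))).
(* From here on only integrals of nonnegative functions are compared, since the expected column
   error may be infinite. *)
apply: (@le_trans _ _ (\int[P]_w ((norm1 beta ^+ 2 * mcs w)%:E + (q w)%:E))%E).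
  apply: ge0_le_integral => //.
  - by move=> w _; rewrite lee_fin sqnorm_ge0.
  - apply/measurable_EFinP; rewrite /sqnorm; apply: measurable_sum => k.
    apply: measurable_funX; under eq_fun do rewrite mxE [X in _ + X]mxE.
    apply: measurable_funB => //; apply: measurable_mx_mul => // i j.
    under eq_fun do rewrite mxE [X in _ + X]mxE.
    by apply: measurable_funD => //; exact: me.
  - by apply: emeasurable_funD; apply/measurable_EFinP => //; exact: measurable_funM.
  - by move=> w _; rewrite -EFinD lee_fin; exact: training_error_le.
rewrite ge0_integralD//; first last.
- exact/measurable_EFinP.
- by move=> w _; rewrite lee_fin.
- by apply/measurable_EFinP; exact: measurable_funM.
- by move=> w _; rewrite lee_fin mulr_ge0 ?sqr_ge0.
apply: leeD.
  under eq_integral do rewrite EFinM.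
  by rewrite ge0_integralZl_EFin ?sqr_ge0//; [move=> w _; rewrite lee_fin|exact/measurable_EFinP].
(* The noise term is bounded with constant [sigma ^+ 2], which is then enlarged to
   [2 * sigma ^+ 2]. *)
apply: le_trans qE _; apply: lee_wpmul2r; first by apply: integral_ge0.
by rewrite lee_fin; have := sqr_ge0 sigma; lra.
Qed.
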